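(* If $G$ is a $B_1$-EPG graph that is diamond-free, then $G$ is a Helly-$B_1$-EPG graph.
   Context: All graphs are finite and simple. An EPG representation of a graph $G$ assigns to each vertex $v$ a path $P_v$ in the (rectangular) grid such that two distinct vertices are adjacent in $G$ if and only if their paths share at least one grid edge. A graph is $B_1$-EPG if it has an EPG representation in which every path has at most one bend. A $B_1$-EPG representation is Helly if the family of edge sets of its paths has the Helly property: every subfamily of paths that pairwise share a grid edge has a grid edge common to all paths of the subfamily. A graph is Helly-$B_1$-EPG if it admits a Helly $B_1$-EPG representation. The diamond is the graph on vertices $a,b,c,d$ with edges $ab,ac,bc,bd,cd$; a graph is diamond-free if it has no induced subgraph isomorphic to the diamond. *)

(* Defs.v *)
From mathcomp Require Import all_boot all_order all_algebra.

Set Implicit Arguments.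
Unset Strict Implicit.
Unset Printing Implicit Defensive.

Import Order.TTheory GRing.Theory Num.Theory.

(* The grid is the integer grid Z x Z; a finite family of paths always lies in
   a finite rectangular part of it. *)
Definition point : Type := (int * int)%type.

Definition grid_adj : rel point := fun u v =>
  ((u.1 == v.1) && (`|u.2 - v.2|%R == 1%R))
  || ((u.2 == v.2) && (`|u.1 - v.1|%R == 1%R)).

Definition steps (T : Type) (s : seq T) : seq (T * T) := zip s (behead s).

(* A path is given by its sequence of pairwise distinct vertices. As usual for
   EPG representations, it is nontrivial: it has at least one edge. *)
Definition grid_path (p : seq point) : bool :=
  [&& 1 < size p, uniq p & sorted grid_adj p].

(* The edge {u, v} is encoded by both of the ordered pairs (u, v), (v, u). *)
Definition edge_set (p : seq point) : pred (point * point) := fun a =>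
  (a \in steps p) || ((a.2, a.1) \in steps p).

Definition horizontal (a : point * point) : bool := a.1.2 == a.2.2.

(* steps (steps p) lists the pairs of consecutive edges of p, that is, its
   internal vertices. *)
Definition bends (p : seq point) : nat :=
  count (fun ab => horizontal ab.1 != horizontal ab.2) (steps (steps p)).

Definition share_edge (p q : seq point) : Prop :=
  exists a, edge_set p a && edge_set q a.

Definition EPG_representation (V : finType) (e : rel V)
    (P : V -> seq point) : Prop :=
  (forall v, grid_path (P v)) /\
  (forall u v, u != v -> (e u v <-> share_edge (P u) (P v))).

Definition Helly (I : finType) (T : Type) (F : I -> pred T) : Prop :=
  forall S : {set I}, S != set0 ->
    (forall i j, i \in S -> j \in S -> i != j -> exists x, F i x && F j x) ->
    exists x, forall i, i \in S -> F i x.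

Definition B_EPG_representation (k : nat) (V : finType) (e : rel V)
    (P : V -> seq point) : Prop :=
  EPG_representation e P /\ (forall v, bends (P v) <= k).

Definition B_EPG (k : nat) (V : finType) (e : rel V) : Prop :=
  exists P : V -> seq point, B_EPG_representation k e P.

Definition Helly_B_EPG (k : nat) (V : finType) (e : rel V) : Prop :=
  exists P : V -> seq point,
    B_EPG_representation k e P /\ Helly (fun v => edge_set (P v)).

(* With a, b, c, d numbered 0, 1, 2, 3, the only missing edge is {0, 3}. *)
Definition diamond : rel 'I_4 := fun i j =>
  (i != j) && ((val i, val j) \notin [:: (0, 3); (3, 0)]).

Definition induced_subgraph (W V : finType) (d : rel W) (e : rel V) : Prop :=
  exists f : W -> V, injective f /\ forall i j, e (f i) (f j) = d i j.

Definition diamond_free (V : finType) (e : rel V) : Prop :=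
  ~ induced_subgraph diamond e.

(* Main.v *)
Require Import Defs.
From mathcomp Require Import all_boot all_order all_algebra.
From mathcomp Require Import zify.

(* A grid path with at most one bend is an L-shape, and a pairwise intersecting
   family of L-shapes either has a common edge or contains a "claw": two shapes
   Q1, Q2 with the same corner x, one arm in the same direction and the other
   ones in opposite directions, and a shape P passing straight through x along
   these opposite arms. Take a representation with as few bent shapes as
   possible. It has no claw: if the shared-direction arm of Q1 is the shorter
   one, replace it by the single edge of Q2 on the other side of x. Everything
   that met the removed arm meets Q2, everything that meets the new edge meets
   P and Q2, and diamond-freeness, applied to the triangle P, Q1, Q2, shows that
   no adjacency changes. But Q1 has lost its bend. *)

Set Implicit Arguments.
Unset Strict Implicit.
Unset Printing Implicit Defensive.

Import Order.TTheory GRing.Theory Num.Theory.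
Local Open Scope ring_scope.

(** * L-shapes *)

(* Axes are booleans, true being the horizontal one: [crd o] is the coordinate
   along the axis [o] and [crd (~~ o)] the one across it. *)
Definition crd (o : bool) (u : point) : int := if o then u.1 else u.2.
Definition mkpt (o : bool) (i j : int) : point := if o then (i, j) else (j, i).

Lemma crd_mkpt o i j : crd o (mkpt o i j) = i.
Proof. by case: o. Qed.

Lemma crdN_mkpt o i j : crd (~~ o) (mkpt o i j) = j.
Proof. by case: o. Qed.

(* The arm along the axis [o] runs from the corner to the point of the same line
   whose coordinate along [o] is that of [tip]; it may be degenerate. So [tip]
   is the corner of the bounding box opposite to [corner]. *)
Record ell := Ell { corner : point; tip : point }.

Definition lo o L := Num.min (crd o (corner L)) (crd o (tip L)).
Definition hi o L := Num.max (crd o (corner L)) (crd o (tip L)).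
Definition line o L := crd (~~ o) (corner L).

(* The unit edge along [o] from [mkpt o i j] to [mkpt o (i + 1) j]. *)
Definition has_edge L o (i j : int) :=
  (j == line o L) && (lo o L <= i < hi o L).

(** Nondegeneracy is required separately: a degenerate arm strictly inside the other one satisfies
    the last two inequalities. *)
Definition share_on o L M :=
  [&& line o L == line o M, lo o L < hi o L, lo o M < hi o M,
      lo o L < hi o M & lo o M < hi o L].

Definition meets L M := share_on true L M || share_on false L M.

Definition bent L := (lo true L < hi true L) && (lo false L < hi false L).

Definition claw o P Q1 Q2 :=
  [&& line o Q1 == line o Q2, share_on (~~ o) Q1 Q2, ~~ share_on o Q1 Q2,
      share_on o P Q1 & share_on o P Q2].

Lemma meetsE o L M : meets L M = share_on o L M || share_on (~~ o) L M.
Proof. by case: o; rewrite // orbC. Qed.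

Lemma bentE o L : bent L = (lo o L < hi o L) && (lo (~~ o) L < hi (~~ o) L).
Proof. by case: o; rewrite // andbC. Qed.

(* For a bent [Q], this trades the arm across [o] for one more edge along [o],
   beyond the corner. *)
Definition straighten o Q :=
  let x := crd o (corner Q) in
  Ell (mkpt o (if crd o (tip Q) < x then x + 1 else x - 1) (line o Q))
      (mkpt o (crd o (tip Q)) (line o Q)).

Definition arm_length o L := `|crd o (tip L) - crd o (corner L)|.

Lemma share_onP o L M :
  reflect (exists i j, has_edge L o i j && has_edge M o i j) (share_on o L M).
Proof.
apply: (iffP idP) => [|[i [j]]]; rewrite /share_on /has_edge; last lia.
move=> h; exists (Num.max (lo o L) (lo o M)), (line o L); lia.
Qed.

Lemma meetsP L M :
  reflect (exists o i j, has_edge L o i j && has_edge M o i j) (meets L M).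
Proof.
apply: (iffP orP) => [[]/share_onP|[[]]/share_onP];
  by [exists true|exists false|left|right].
Qed.

(** Equal lines along both axes make the corners of [Q1] and [Q2] coincide. Their arms along [o]
    start there without a common edge, hence are opposite; the arm of [P] reaches into both, so it
    passes through the corner. *)
Lemma clawP o P Q1 Q2 (x := crd o (corner Q1)) (y := line o Q1) :
  claw o P Q1 Q2 ->
  [/\ [/\ crd o (corner Q2) = x, line o P = y & line o Q2 = y],
      lo o P < x < hi o P,
      (crd o (tip Q1) < x < crd o (tip Q2)) ||
      (crd o (tip Q2) < x < crd o (tip Q1)) &
      (crd (~~ o) (tip Q1) < y) && (crd (~~ o) (tip Q2) < y) ||
      (y < crd (~~ o) (tip Q1)) && (y < crd (~~ o) (tip Q2))].
Proof.
rewrite /claw /share_on => /and5P[/eqP e1 /and5P[/eqP e2 h1 h2 h3 h4] n].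
move=> /and5P[/eqP f1 l1 l2 l3 l4] /and5P[/eqP f2 k1 k2 k3 k4].
move: n; rewrite e1 eqxx /=.
move: h1 h2 h3 h4 l1 l2 l3 l4 k1 k2 k3 k4; rewrite {}/x {}/y.
move: e1 e2 f1 f2; rewrite /lo /hi /line ?negbK => *.
by split; [split|..]; lia.
Qed.

Lemma has_edge_straighten o Q i j (x := crd o (corner Q)) (t := crd o (tip Q)) :
  t != x ->
  has_edge (straighten o Q) o i j =
  (j == line o Q) && ((t < x) && (t <= i <= x) || (x < t) && (x - 1 <= i < t)).
Proof.
rewrite /has_edge {1}/line /lo /hi /= !crd_mkpt !crdN_mkpt {}/x {}/t.
by case: ltP; lia.
Qed.

Lemma has_edge_straightenN o Q i j : has_edge (straighten o Q) (~~ o) i j = false.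
Proof. by rewrite /has_edge /lo /hi /= !crdN_mkpt minxx maxxx; lia. Qed.

Lemma eq_or_neg (o o' : bool) : o' = o \/ o' = ~~ o.
Proof. by case: o o' => [] []; auto. Qed.

(** The only new edge lies just beyond the corner, where both [P] and the opposite arm of [Q2]
    contain it. *)
Lemma meets_straighten o P Q1 Q2 M : claw o P Q1 Q2 ->
  meets (straighten o Q1) M -> meets Q1 M || (meets P M && meets Q2 M).
Proof.
move=> /clawP[[e1 e2 e3] hP ht _] /meetsP[o' [i [j /andP[hS hM]]]].
suff: has_edge Q1 o' i j || (has_edge P o' i j && has_edge Q2 o' i j).
  case/orP=> [h|/andP[h h']]; apply/orP; [left|right; apply/andP; split];
  by apply/meetsP; exists o', i, j; rewrite hM andbT.
case: (eq_or_neg o o') hS => ->; last by rewrite has_edge_straightenN.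
rewrite has_edge_straighten; last lia.
by move: hP ht; rewrite /has_edge e2 e3 /lo /hi e1; lia.
Qed.

(** A lost edge is across [o], and the length hypothesis puts it on [Q2]. *)
Lemma straighten_meets o P Q1 Q2 M : claw o P Q1 Q2 ->
  arm_length (~~ o) Q1 <= arm_length (~~ o) Q2 -> meets Q1 M ->
  meets (straighten o Q1) M || (meets Q2 M && ~~ meets P M).
Proof.
move=> /clawP[[e1 e2 e3] hP ht hs] ha /meetsP[o' [i [j /andP[hQ hM]]]].
case: (boolP (meets _ M)) => //= nS.
have noS o1 i1 j1 :
    has_edge M o1 i1 j1 -> ~~ has_edge (straighten o Q1) o1 i1 j1.
  move=> hM1; apply: contra nS => hS.
  by apply/meetsP; exists o1, i1, j1; rewrite hS.
case: (eq_or_neg o o') hQ hM => -> hQ hM.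
  have := noS _ _ _ hM; rewrite has_edge_straighten; last lia.
  by move: hQ ht; rewrite /has_edge /lo /hi; lia.
apply/andP; split.
  apply/meetsP; exists (~~ o), i, j; rewrite hM andbT.
  move: ha hs hQ; rewrite /has_edge /arm_length /lo /hi ?negbK.
  by move: e3; rewrite /line ?negbK e1 => ->; lia.
apply/negP => /meetsP[o1 [i1 [j1 /andP[hP1 hM1]]]].
(* Across [o] this is impossible: [P] has its corner at an end of its arm along [o], hence off the
   line across [o] that carries [M]. *)
case: (eq_or_neg o o1) hP1 hM1 => -> hP1 hM1; last first.
  move: hP hP1 hM1 hM hQ; rewrite /has_edge /lo /hi /line ?negbK.
  by lia.
(* [M] has edges on both lines through the corner of [Q1], so its own corner is there, and its arm
   along [o] starts with one of the two edges at that point. The straightened shape contains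
   both. *)
have hx : has_edge M o (crd o (corner Q1)) (line o Q1) ||
          has_edge M o (crd o (corner Q1) - 1) (line o Q1).
  by move: hQ hM hM1 hP1; rewrite /has_edge /lo /hi e2 /line ?negbK; lia.
by case/orP: hx => /noS; rewrite has_edge_straighten; lia.
Qed.

Lemma bent_claw o P Q1 Q2 : claw o P Q1 Q2 -> bent Q1.
Proof.
rewrite /claw !(bentE o) /share_on.
by move=> /and5P[_ /and5P[_ -> _ _ _] _ /and5P[_ _ ->]].
Qed.

Lemma bent_straighten o L : ~~ bent (straighten o L).
Proof.
by rewrite (bentE o) /straighten /lo /hi /= !crdN_mkpt minxx maxxx ltxx andbF.
Qed.

Lemma share_onC o L M : share_on o L M = share_on o M L.
Proof. by rewrite /share_on; lia. Qed.

Lemma meetsC M N : meets M N = meets N M.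
Proof. by rewrite /meets !(share_onC _ M). Qed.

Lemma straighten_self o P Q1 Q2 :
  claw o P Q1 Q2 -> meets (straighten o Q1) (straighten o Q1).
Proof.
move=> c; have [_ _ ht _] := clawP c.
pose x := crd o (corner Q1); pose t := crd o (tip Q1).
apply/meetsP; exists o, (if t < x then x else x - 1), (line o Q1).
by rewrite has_edge_straighten; [case: ltP; lia|lia].
Qed.

Lemma claw_sym o P Q1 Q2 : claw o P Q1 Q2 -> claw o P Q2 Q1.
Proof.
rewrite /claw => /and5P[/eqP -> s1 s2 s3 s4].
by rewrite eqxx share_onC s1 share_onC s2 s4 s3.
Qed.

Lemma claw_meets o P Q1 Q2 : claw o P Q1 Q2 ->
  [&& meets Q1 Q2, meets P Q1 & meets P Q2].
Proof. by rewrite /claw !(meetsE o) => /and5P[_ -> _ -> ->]; rewrite orbT. Qed.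

Lemma claw_neq o P Q1 Q2 : claw o P Q1 Q2 ->
  [/\ Q1 <> Q2, P <> Q1 & P <> Q2].
Proof.
move=> /and5P[_ _ n s1 s2]; split=> E; case/negP: n.
- by move: s1; rewrite -E /share_on => /and5P[_ _ -> _ _]; rewrite eqxx.
- by rewrite -E.
- by rewrite share_onC -E.
Qed.

(** * Pairwise intersecting families *)

Section Family.

Variables (V : finType) (L : V -> ell).

(** Helly's theorem for intervals: a common edge starts at the greatest lower end. *)
Lemma interval_helly o (S : {set V}) : S != set0 ->
  (forall u v, u \in S -> v \in S -> share_on o (L u) (L v)) ->
  exists i j, forall v, v \in S -> has_edge (L v) o i j.
Proof.
case/set0Pn => v0 Sv0 hS.
case: (@arg_maxP _ _ _ v0 (mem S) (fun v => lo o (L v)) Sv0) => m Sm hm.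
exists (lo o (L m)), (line o (L m)) => v Sv.
have := hS _ _ Sm Sv; have := hm v Sv.
by rewrite /has_edge /share_on; lia.
Qed.

(** If the arms of [u] and [v] along [o] do not overlap, these shapes share an edge across [o],
    hence have the same corner. A member overlapping both along [o] gives a claw. Otherwise each
    member meets one of them across [o], so it has the same corner and an arm in the same
    direction. *)
Lemma collinear_helly o (S : {set V}) : S != set0 ->
  (forall u v, u \in S -> v \in S -> meets (L u) (L v)) ->
  (forall u v, u \in S -> v \in S ->
     (line o (L u) == line o (L v)) && (lo o (L u) < hi o (L u))) ->
  (exists o i j, forall v, v \in S -> has_edge (L v) o i j) \/
  (exists p u v, claw o (L p) (L u) (L v)).
Proof.
move=> S0 hm hl.
case: (boolP [forall u in S, forall v in S, share_on o (L u) (L v)]).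
  move=> /forall_inP h; left; exists o; apply: interval_helly => // u v Su Sv.
  by have /forall_inP := h u Su; apply.
case/forall_inPn => u Su /forall_inPn [v Sv nuv].
have huv : share_on (~~ o) (L u) (L v).
  by have := hm u v Su Sv; rewrite (meetsE o) (negPf nuv).
have /andP[luv nu] := hl u v Su Sv; have /andP[_ nv] := hl v u Sv Su.
case: (boolP [exists p in S, share_on o (L p) (L u) && share_on o (L p) (L v)]).
  case/exists_inP => p _ /andP[pu pv]; right; exists p, u, v.
  by rewrite /claw luv huv nuv pu pv.
(* The common edge is the first one of the arms of [u] and [v] across [o]. *)
move=> /exists_inPn hn; left; pose y := line o (L u).
exists (~~ o), (if crd (~~ o) (tip (L u)) < y then y - 1 else y).
exists (line (~~ o) (L u)) => p Sp.
have /andP[lpu np] := hl p u Sp Su.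
have := hm p u Sp Su; have := hm p v Sp Sv; have := hn p Sp.
rewrite !(meetsE o) negb_and => h1 h2 h3; move: h1.
case/orP => /negPf hf; rewrite hf in h2 h3 *;
  move: h2 h3 => /orP[] // h2 /orP[] // h3.
all: move: huv nuv luv nu nv lpu np h2 h3; rewrite {}/y; clear.
all: rewrite /share_on /has_edge /line /lo /hi ?negbK.
all: by case: (ltP (crd (~~ o) (tip (L u)))); lia.
Qed.

Lemma helly_or_claw (S : {set V}) : S != set0 ->
  (forall u v, u \in S -> v \in S -> meets (L u) (L v)) ->
  (exists o i j, forall v, v \in S -> has_edge (L v) o i j) \/
  (exists o p u v, claw o (L p) (L u) (L v)).
Proof.
move=> S0 hm.
pose col o := [forall u in S, forall v in S,
     (line o (L u) == line o (L v)) && (lo o (L u) < hi o (L u))].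
suff: col true || col false.
  have colP o : col o ->
      (exists o i j, forall v, v \in S -> has_edge (L v) o i j) \/
      (exists o p u v, claw o (L p) (L u) (L v)).
    move=> /forall_inP h; case: (@collinear_helly o S S0 hm) => [u v Su Sv||].
    - by have /forall_inP := h u Su; apply.
    - by left.
    - by right; exists o.
  by case/orP => /colP.
(* There is a failing pair for each axis. If [L u] has no horizontal arm, [L u'] and [L v'] meet it
   vertically and do not fail; likewise with the axes exchanged. Otherwise [L u] and [L v] are on
   two horizontal lines, hence on one vertical line; one of [L u'], [L v'] is off the latter and
   would have to meet both horizontally. *)
apply: contraT; rewrite negb_or => /andP[].
case/forall_inPn => u Su /forall_inPn [v Sv huv].
case/forall_inPn => u' Su' /forall_inPn [v' Sv' huv'].
have := (hm _ _ Su Su', hm _ _ Su Sv', hm _ _ Sv Su', hm _ _ Sv Sv').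
have := (hm _ _ Su Sv, hm _ _ Su' Sv', hm _ _ Su Su).
move: huv huv'; rewrite /meets /share_on => ? ? [[? ?] ?] [[[? ?] ?] ?].
by lia.
Qed.

End Family.

(** * Removing claws *)

Section Representation.

Variables (V : finType) (e : rel V).
Hypotheses (e_sym : symmetric e) (e_irr : irreflexive e).
Hypothesis e_df : diamond_free e.

(** Otherwise [x], [a], [b], [y], in this order, induce the diamond, whose missing edge joins its
    first and last vertices. *)
Lemma diamond_freeP a b x y :
  x != y -> e a b -> e a x -> e a y -> e b x -> e b y -> e x y.
Proof.
move=> nxy ab ax ay bx bY; apply: contraT => exy; case: e_df.
pose f (i : 'I_4) := nth x [:: x; a; b; y] i; exists f.
have ne u v : e u v -> u != v by apply: contraTneq => ->; rewrite e_irr.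
have E i j : e (f i) (f j) = diamond i j.
  rewrite /f /diamond -val_eqE.
  case: i j => [[|[|[|[|?]]]] ?] [[|[|[|[|?]]]] ?] //=; rewrite ?e_irr //;
    first [by rewrite ?(ab, ax, ay, bx, bY, negPf exy)
          |by rewrite e_sym ?(ab, ax, ay, bx, bY, negPf exy)].
have fU : uniq [:: x; a; b; y].
  rewrite /= !inE !negb_or nxy (ne _ _ ab) (ne _ _ ay) (ne _ _ bY).
  by rewrite ![x == _]eq_sym (ne _ _ ax) (ne _ _ bx).
split=> // i j /eqP; rewrite /f nth_uniq // => /eqP ij.
exact: val_inj.
Qed.

(** The first condition says that no shape is a single point. *)
Definition ell_rep (L : V -> ell) :=
  (forall v, meets (L v) (L v)) /\
  (forall u v, u != v -> e u v = meets (L u) (L v)).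

Lemma unclaw L o a b c : ell_rep L -> claw o (L a) (L b) (L c) ->
  exists2 L', ell_rep L' &
    (#|[set v | bent (L' v)]| < #|[set v | bent (L v)]|)%N.
Proof.
move=> [hL hE]; wlog hbc: b c / arm_length (~~ o) (L b) <= arm_length (~~ o) (L c).
  have := le_total (arm_length (~~ o) (L b)) (arm_length (~~ o) (L c)).
  case/orP=> h W cl; first exact: (W b c).
  by apply: (W c b) => //; exact: claw_sym.
move=> cl; exists (fun v => if v == b then straighten o (L b) else L v); last first.
  apply: proper_card; apply/properP; split.
    apply/subsetP=> v; rewrite !inE; case: eqP => // ->.
    by rewrite (negPf (bent_straighten _ _)).
  by exists b; rewrite !inE ?(bent_claw cl) ?eqxx ?bent_straighten.
have /and3P[mbc mab mac] := claw_meets cl.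
have [nbc nab nac] := claw_neq cl.
have {}nbc : b != c by apply/eqP=> E; apply: nbc; rewrite E.
have {}nab : a != b by apply/eqP=> E; apply: nab; rewrite E.
have {}nac : a != c by apply/eqP=> E; apply: nac; rewrite E.
have eab : e a b by rewrite hE.
have eac : e a c by rewrite hE.
have ebc : e b c by rewrite hE.
have main q : q != b -> e b q = meets (straighten o (L b)) (L q).
  move=> qb; rewrite hE 1?eq_sym //; apply/idP/idP.
    move=> m; apply: contraT => nS.
    (* If the adjacency were lost, [a] and [q] would be nonadjacent common neighbours of the
       adjacent [b] and [c]. *)
    have := straighten_meets cl hbc m; rewrite (negPf nS) /= => /andP[mc na].
    have qa : a != q by apply: contraNneq na => <-.
    have qc : c != q by apply: contraNneq na => <-.
    move: na; rewrite -hE // (@diamond_freeP b c) //; first by rewrite e_sym.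
    - by rewrite hE // eq_sym.
    - by rewrite e_sym.
    - by rewrite hE.
  (* If an adjacency were gained, [b] and [q] would be nonadjacent common neighbours of the adjacent
     [a] and [c]. *)
  move=> /(meets_straighten cl) /orP[//|/andP[ma mc]].
  have [->|qa] := eqVneq q a; first by rewrite meetsC.
  have [->//|qc] := eqVneq q c.
  rewrite -hE 1?eq_sym // (@diamond_freeP a c) 1?eq_sym //.
  - by rewrite hE 1?eq_sym.
  - by rewrite e_sym.
  - by rewrite hE 1?eq_sym.
split=> [v|u v uv]; first by case: eqP => // _; exact: straighten_self cl.
have [Eu|nu] := eqVneq u b; have [Ev|nv] := eqVneq v b.
- by rewrite Eu Ev eqxx in uv.
- by rewrite Eu main.
- by rewrite Ev e_sym main // meetsC.
- exact: hE.
Qed.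

Lemma ell_rep_helly L : ell_rep L -> exists2 L', ell_rep L' &
  forall S : {set V}, S != set0 -> {in S &, forall u v, meets (L' u) (L' v)} ->
  exists o i j, {in S, forall v, has_edge (L' v) o i j}.
Proof.
have [n] := ubnP #|[set v | bent (L v)]|; elim: n L => // n IHn L hn hL.
pose has_claw := [exists o, exists p, exists u, exists v,
  claw o (L p) (L u) (L v)].
case: (boolP has_claw) => [|ncl].
  case/existsP=> o /existsP[p /existsP[u /existsP[v cl]]].
  have [L' hL' lt] := unclaw hL cl.
  by apply: (IHn L') => //; exact: leq_trans lt _.
exists L => // S S0 hS.
case: (helly_or_claw S0 hS) => // -[o [p [u [v cl]]]].
case/existsP: ncl; exists o; apply/existsP; exists p; apply/existsP; exists u.
by apply/existsP; exists v.
Qed.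

End Representation.

(** * Paths and L-shapes *)

Lemma crd_inj o u v : crd o u = crd o v -> crd (~~ o) u = crd (~~ o) v -> u = v.
Proof. by case: o u v => [] [? ?] [? ?] /= -> ->. Qed.

Definition aligned o (u v : point) :=
  (crd (~~ o) u == crd (~~ o) v) && (`|crd o u - crd o v| == 1).

Lemma eqNb (o : bool) : (~~ o == o) = false.
Proof. by case: o. Qed.

Lemma eqbN (o : bool) : (o == ~~ o) = false.
Proof. by case: o. Qed.

Lemma grid_adjP u v : reflect (exists o, aligned o u v) (grid_adj u v).
Proof.
by apply: (iffP orP) => [[]|[[]]]; [exists false|exists true|right|left].
Qed.

Lemma horizontal_aligned o u v : aligned o u v -> horizontal (u, v) = o.
Proof. by rewrite /aligned /horizontal; case: o => /=; lia. Qed.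

(** Of the two ordered pairs encoding an edge, the canonical one has the lower end first. *)
Definition edge_of o (i j : int) := (mkpt o i j, mkpt o (i + 1) j).

Lemma edge_ofE o u v o' i j : aligned o u v ->
  (edge_of o' i j == (u, v)) || (edge_of o' i j == (v, u)) =
  [&& o' == o, j == crd (~~ o) u & i == Num.min (crd o u) (crd o v)].
Proof.
rewrite /aligned /edge_of; case: o o' u v => [] [] [? ?] [? ?] /=.
all: rewrite !xpair_eqE /=; lia.
Qed.

Lemma edge_set_cons u v s o i j :
  edge_set [:: u, v & s] (edge_of o i j) =
  (edge_of o i j == (u, v)) || (edge_of o i j == (v, u)) ||
  edge_set (v :: s) (edge_of o i j).
Proof.
rewrite /edge_set /steps /= !inE !xpair_eqE [(mkpt o (i + 1) j == u) && _]andbC.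
by rewrite orbACA -!orbA.
Qed.

Lemma bends_cons u v w s : bends [:: u, v, w & s] =
  ((horizontal (u, v) != horizontal (v, w)) + bends [:: v, w & s])%N.
Proof. by []. Qed.

(** Vertices are tracked besides edges to keep a growing path free of repetitions. *)
Definition on_ell L z := [exists o, (crd (~~ o) z == line o L) &&
  (lo o L <= crd o z <= hi o L)].

Lemma on_ellE o L z : on_ell L z =
  (crd (~~ o) z == line o L) && (lo o L <= crd o z <= hi o L) ||
  (crd o z == line (~~ o) L) && (lo (~~ o) L <= crd (~~ o) z <= hi (~~ o) L).
Proof.
rewrite /on_ell; apply/existsP/orP => [[o']|[]h].
- by case: (eq_or_neg o o') => ->; rewrite ?negbK; auto.
- by exists o.
- by exists (~~ o); rewrite negbK.
Qed.

Definition represents p L :=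
  forall o i j, edge_set p (edge_of o i j) = has_edge L o i j.

(* The path [u, v, s] runs through the whole of [L], starting with the arm along
   [o]. The form is the one needed to add vertices at the front: the first
   vertex [u] is the free end of that arm, and the second one lies on it. *)
Record traces o L u v s : Prop := Traces {
  traces_path : grid_path [:: u, v & s];
  traces_edge : represents [:: u, v & s] L;
  traces_on : {in [:: u, v & s], forall z, on_ell L z};
  traces_bends : bends [:: u, v & s] = bent L;
  traces_tip : crd o u = crd o (tip L);
  traces_line : crd (~~ o) u = line o L;
  traces_aligned : aligned o u v;
  traces_arm : lo o L <= crd o v <= hi o L }.

Lemma traces_start o u v : aligned o u v -> traces o (Ell v u) u v [::].
Proof.
move=> al; split=> //.
- rewrite /grid_path /= andbT inE; apply/andP; split.
    by apply: contraTneq al => ->; rewrite /aligned; lia.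
  by rewrite andbT; apply/grid_adjP; exists o.
- move=> o' i j; rewrite edge_set_cons /= (edge_ofE _ _ _ al) /edge_set /= orbF.
  case: (eq_or_neg o o') => ->; move: al; rewrite /aligned /has_edge /lo /hi /line /=;
    by rewrite ?negbK ?eqxx; case: o => /=; lia.
- move=> z; rewrite !inE => /orP[] /eqP ->; rewrite (on_ellE o) /lo /hi /line /= ?negbK;
    by move: al; rewrite /aligned; lia.
- by move: al; rewrite /bends (bentE o) /aligned /lo /hi /=; lia.
- by case/andP: al => /eqP.
- by rewrite /lo /hi /=; lia.
Qed.

Lemma traces_cons o L u v s o' L' w : traces o L u v s ->
  aligned o' w u ->
  (forall o1 i j, has_edge L' o1 i j =
    [&& o1 == o', j == crd (~~ o') w & i == Num.min (crd o' w) (crd o' u)] ||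
    has_edge L o1 i j) ->
  (forall z, on_ell L z -> on_ell L' z) -> ~~ on_ell L w -> on_ell L' w ->
  bent L' = ((o' != o) + bent L)%N :> nat ->
  crd o' w = crd o' (tip L') -> crd (~~ o') w = line o' L' ->
  lo o' L' <= crd o' u <= hi o' L' ->
  traces o' L' w u (v :: s).
Proof.
move=> [/and3P[sz un so] ed on bn tp ln al ar] al' ed' on' nw onw bn' tp' ln' ar'.
split=> //.
- apply/and3P; split=> //; last first.
    by rewrite /= in so *; rewrite so andbT; apply/grid_adjP; exists o'.
  by rewrite cons_uniq un andbT; apply: contra nw => /on.
- by move=> o1 i j; rewrite edge_set_cons ed ed' (edge_ofE _ _ _ al').
- by move=> z; rewrite inE => /orP[/eqP->//|/on/on'].
- by rewrite bends_cons bn (horizontal_aligned al') (horizontal_aligned al) bn'.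
Qed.

Definition set_tip o t L := Ell (corner L) (mkpt o t (crd (~~ o) (tip L))).

(** Since [w != v] excludes stepping back, the tip moves outwards. *)
Lemma traces_extend o L u v s w : traces o L u v s -> aligned o w u -> w != v ->
  traces o (set_tip o (crd o w) L) w u (v :: s).
Proof.
move=> T al wv; have [_ _ _ _ tp ln al' ar] := T.
have {}wv : crd o w != crd o v.
  apply: contraNneq wv => E; apply/eqP; apply: (@crd_inj o) => //.
  by move: al al'; rewrite /aligned; lia.
apply: (traces_cons T) => //.
- move=> o1 i j; case: (eq_or_neg o o1) => ->; last first.
    by rewrite /has_edge /line /lo /hi /= crdN_mkpt eqNb.
  rewrite /has_edge /line /lo /hi /= crd_mkpt eqxx /=.
  by move: al al' wv tp ln ar; rewrite /aligned /lo /hi /line; lia.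
- move=> z; rewrite !(on_ellE o) /lo /hi /line /= !crd_mkpt !crdN_mkpt.
  by move: al al' wv tp ln ar; rewrite /aligned /lo /hi /line; lia.
- rewrite !(on_ellE o) /lo /hi /line /= ?negbK.
  by move: al al' wv tp ln ar; rewrite /aligned /lo /hi /line; lia.
- rewrite !(on_ellE o) /lo /hi /line /= !crd_mkpt !crdN_mkpt ?negbK.
  by move: al al' wv tp ln ar; rewrite /aligned /lo /hi /line; lia.
- rewrite !(bentE o) /lo /hi /line /= !crd_mkpt !crdN_mkpt eqxx add0n.
  congr nat_of_bool.
  by move: al al' wv tp ln ar; rewrite /aligned /lo /hi /line; lia.
- by rewrite /= crd_mkpt.
- by rewrite /line /=; move: al ln; rewrite /aligned /line; lia.
- rewrite /lo /hi /= !crd_mkpt.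
  by move: al al' wv tp ln ar; rewrite /aligned /lo /hi /line; lia.
Qed.

(* The old corner becomes an end of the path and [u] the new corner. *)
Lemma traces_turn o L u v s w :
  traces o L u v s -> aligned (~~ o) w u -> ~~ bent L ->
  traces (~~ o) (Ell u (mkpt o (crd o (corner L)) (crd (~~ o) w))) w u (v :: s).
Proof.
move=> T al nb; have [_ _ _ _ tp ln al' ar] := T.
have E : crd (~~ o) (corner L) = crd (~~ o) (tip L).
  by move: nb tp ln al' ar; rewrite (bentE o) /aligned /lo /hi /line; lia.
apply: (traces_cons T) => //.
- move=> o1 i j; case: (eq_or_neg o o1) => ->;
    rewrite /has_edge /line /lo /hi /= ?crd_mkpt ?crdN_mkpt ?negbK;
    rewrite ?eqxx ?eqNb ?eqbN;
    by move: al al' tp ln ar; rewrite /aligned /lo /hi /line ?negbK; lia.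
- move=> z; rewrite !(on_ellE o) /lo /hi /line /= !crd_mkpt !crdN_mkpt ?negbK.
  by move: al al' tp ln ar; rewrite /aligned /lo /hi /line ?negbK; lia.
- rewrite !(on_ellE o) /lo /hi /line /= ?negbK.
  by move: al al' tp ln ar; rewrite /aligned /lo /hi /line ?negbK; lia.
- rewrite !(on_ellE o) /lo /hi /line /= !crd_mkpt !crdN_mkpt ?negbK.
  by move: al al' tp ln ar; rewrite /aligned /lo /hi /line ?negbK; lia.
- rewrite (negPf nb) addn0 eqNb /= !(bentE o) /lo /hi /line /=.
  rewrite !crd_mkpt !crdN_mkpt.
  by move: al al' tp ln ar; rewrite /aligned /lo /hi /line ?negbK; lia.
- by rewrite /= crdN_mkpt.
- by rewrite /line negbK /=; move: al ln; rewrite /aligned /line negbK; lia.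
- rewrite /lo /hi /= !crdN_mkpt.
  by move: al al' tp ln ar; rewrite /aligned /lo /hi /line; lia.
Qed.

Lemma mkptN o i j : mkpt (~~ o) i j = mkpt o j i.
Proof. by case: o. Qed.

(** Vertices are added at the front, going straight on or turning; the bound on bends allows a turn
    only while the shape is still unbent. *)
Lemma grid_path_traces u v s :
  grid_path [:: u, v & s] -> (bends [:: u, v & s] <= 1)%N ->
  exists o L, traces o L u v s.
Proof.
elim: s u v => [|v s IHs] w u gp bd;
  move: (gp) => /and3P[_ /= /andP[wn un] /andP[/grid_adjP[o' al'] so]].
  by exists o', (Ell u w); apply: traces_start.
have gp' : grid_path [:: u, v & s] by apply/and3P.
move: bd; rewrite bends_cons (horizontal_aligned al') => bd.
have [|o [L T]] := IHs u v gp'; first lia.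
have [_ _ _ bn _ _ al _] := T; rewrite (horizontal_aligned al) bn in bd.
case: (eq_or_neg o o') => E; subst o'.
  exists o, (set_tip o (crd o w) L); apply: traces_extend => //.
  by move: wn; rewrite !inE !negb_or => /and3P[].
exists (~~ o); eexists; apply: traces_turn T al' _.
by move: bd; rewrite eqNb /=; case: (bent L).
Qed.

Lemma mkpt_crd o u : mkpt o (crd o u) (crd (~~ o) u) = u.
Proof. by case: o u => [] []. Qed.

(** The tip moves by unit steps towards [t]; lying between the corner and [t], it only ever moves
    outwards. *)
Lemma traces_extend_to o L u v s t : traces o L u v s ->
  Num.min (crd o (corner L)) t <= crd o (tip L) <= Num.max (crd o (corner L)) t ->
  exists u v s, traces o (set_tip o t L) u v s.
Proof.
have [n] := ubnP `|t - crd o (tip L)|%N.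
elim: n L u v s => // n IHn L u v s hn T ht; have [_ _ _ _ tp ln al ar] := T.
have [->|nt] := eqVneq t (crd o (tip L)).
  by exists u, v, s; move: T; rewrite /set_tip mkpt_crd; case: (L).
set w := mkpt o (if t < crd o u then crd o u - 1 else crd o u + 1)
              (crd (~~ o) u).
have wE : crd o w = if t < crd o u then crd o u - 1 else crd o u + 1.
  by rewrite crd_mkpt.
have alw : aligned o w u.
  by rewrite /aligned wE crdN_mkpt eqxx; case: ltP; lia.
have nwv : w != v.
  apply: contraTneq al => E; move: wE ht ar tp nt; rewrite E /aligned /lo /hi.
  by case: ltP; lia.
have T' := traces_extend T alw nwv.
have [||u' [v' [s']]] := IHn _ _ _ _ _ T'.
- by rewrite /= crd_mkpt wE; move: hn; rewrite -tp; case: ltP; lia.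
- rewrite /= crd_mkpt wE; move: ht nt ar al; rewrite -tp /aligned /lo /hi -tp.
  by case: ltP; lia.
by rewrite /set_tip /= crdN_mkpt => T2; exists u', v', s'.
Qed.

Lemma ell_of_path p : grid_path p -> (bends p <= 1)%N -> exists L, represents p L.
Proof.
case: p => [|u [|v s]] // gp bd.
by have [o [L T]] := grid_path_traces gp bd; exists L; case: T.
Qed.

Lemma straight_path o x t y : x != t -> exists u v s,
  traces o (Ell (mkpt o x y) (mkpt o t y)) u v s.
Proof.
move=> xt; set w := mkpt o (if t < x then x - 1 else x + 1) y.
have al : aligned o w (mkpt o x y).
  by rewrite /aligned !crdN_mkpt !crd_mkpt eqxx; case: ltP; lia.
have [|u [v [s T]]] := traces_extend_to (t := t) (traces_start al).
  by rewrite /= !crd_mkpt; case: ltP; lia.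
by exists u, v, s; rewrite /set_tip /= crdN_mkpt in T.
Qed.

Lemma path_of_ell L : meets L L ->
  exists p, [/\ grid_path p, (bends p <= 1)%N & represents p L].
Proof.
have fin o L' u v s : traces o L' u v s ->
    (forall o i j, has_edge L' o i j = has_edge L o i j) ->
    exists p, [/\ grid_path p, (bends p <= 1)%N & represents p L].
  move=> [gp ed _ bn _ _ _ _] E; exists [:: u, v & s]; split=> //.
    by rewrite bn; case: bent.
  by move=> o' i j; rewrite ed E.
move=> m; have [o ho] : exists o, lo o L < hi o L.
  by case/orP: m => /and5P[_ h _ _ _]; eexists; exact: h.
have nxt : crd o (tip L) != crd o (corner L) by move: ho; rewrite /lo /hi; lia.
(* Corner and tip are exchanged along [o]: the path grows at its tip, which has to be at the corner
   of [L], where the turn may come. *)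
have [u [v [s T]]] := straight_path o (line o L) nxt.
have [_ _ _ _ /= tp ln al ar] := T; rewrite /line /= crd_mkpt crdN_mkpt in tp ln.
have [E|nE] := eqVneq (crd (~~ o) (tip L)) (line o L).
  apply: (fin _ _ _ _ _ T) => o' i j.
  case: (eq_or_neg o o') => ->; rewrite /has_edge /lo /hi /line /=;
    rewrite ?crd_mkpt ?crdN_mkpt ?negbK ?crd_mkpt.
    by lia.
  by move: E; rewrite /line; lia.
set w := mkpt o (crd o (corner L))
  (if crd (~~ o) (tip L) < line o L then line o L - 1 else line o L + 1).
have alw : aligned (~~ o) w u.
  by rewrite /aligned negbK crd_mkpt crdN_mkpt tp eqxx ln /line; case: ltP; lia.
have nb : ~~ bent (Ell (mkpt o (crd o (tip L)) (line o L))
                       (mkpt o (crd o (corner L)) (line o L))).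
  by rewrite (bentE o) /lo /hi /= !crdN_mkpt; lia.
have T2 := traces_turn T alw nb.
have [|u' [v' [s' T3]]] := traces_extend_to (t := crd (~~ o) (tip L)) T2.
  move: nE; rewrite /= !crdN_mkpt ln /line.
  by case: (ltP (crd (~~ o) (tip L))); lia.
apply: (fin _ _ _ _ _ T3) => o' i j.
rewrite /set_tip /has_edge.
case: (eq_or_neg o o') => ->; rewrite /lo /hi /line /= ?negbK.
all: by rewrite !(mkptN, crd_mkpt, crdN_mkpt); lia.
Qed.

Lemma edge_set_swap p u v : edge_set p (v, u) = edge_set p (u, v).
Proof. exact: orbC. Qed.

Lemma steps_adj p u v : grid_path p -> (u, v) \in steps p -> grid_adj u v.
Proof.
case/and3P => _ _; case: p => // x p; elim: p x => // y p IHp x /= /andP[xy yp].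
by rewrite inE => /orP[/eqP[-> ->]//|]; exact: IHp.
Qed.

Lemma aligned_edge_of o u v : aligned o u v ->
  exists i j, (u, v) = edge_of o i j \/ (v, u) = edge_of o i j.
Proof.
move=> al; exists (Num.min (crd o u) (crd o v)), (crd (~~ o) u).
have := edge_ofE o (Num.min (crd o u) (crd o v)) (crd (~~ o) u) al.
by rewrite !eqxx => /orP[]/eqP->; auto.
Qed.

(** Uniformity in [q] gives an edge shared by two paths the same canonical form in both. *)
Lemma edge_set_edge_of p a : grid_path p -> edge_set p a ->
  exists o i j, forall q, edge_set q a = edge_set q (edge_of o i j).
Proof.
case: a => u v gp; wlog : u v / (u, v) \in steps p => [W|h _].
  case/orP=> h; first by apply: W => //; rewrite /edge_set h.
  have [|o [i [j E]]] := W _ _ h; first by rewrite /edge_set h.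
  by exists o, i, j => q; rewrite -E edge_set_swap.
have /grid_adjP[o al] := steps_adj gp h; have [i [j E]] := aligned_edge_of al.
by exists o, i, j => q; case: E => <-; rewrite // edge_set_swap.
Qed.

Lemma share_edge_meets p q L M :
  grid_path p -> represents p L -> represents q M ->
  share_edge p q <-> meets L M.
Proof.
move=> gp pL qM; split=> [|/meetsP[o [i [j h]]]].
  case=> a /andP[ap aq].
  have [o [i [j E]]] := edge_set_edge_of gp ap; apply/meetsP; exists o, i, j.
  by rewrite -pL -qM -!E ap.
by exists (edge_of o i j); rewrite pL qM.
Qed.

Theorem theorem2 (V : finType) (e : rel V)
  (e_sym : symmetric e) (e_irr : irreflexive e) :
  B_EPG 1 e -> diamond_free e -> Helly_B_EPG 1 e.
Proof.
move=> [P [[gP eP] bP]] df.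
have [L hL] := fin_all_exists (fun v => ell_of_path (gP v) (bP v)).
have rL : ell_rep e L.
  split=> [v|u v uv].
    apply/(share_edge_meets (gP v) (hL v) (hL v)).
    case: (P v) (gP v) => [|x [|y s]] // _; exists (x, y).
    by rewrite /edge_set /= mem_head.
  have mE := share_edge_meets (gP u) (hL u) (hL v).
  by apply/idP/idP=> [/(eP u v uv)/mE|/mE/(eP u v uv)].
have [L' [mL' eL'] helly] := ell_rep_helly e_sym e_irr df rL.
have [Q hQ] := fin_all_exists (fun v => path_of_ell (mL' v)).
have shE u v : share_edge (Q u) (Q v) <-> meets (L' u) (L' v).
  by have [gu _ ru] := hQ u; have [_ _ rv] := hQ v; exact: share_edge_meets.
exists Q; split.
  split; last by move=> v; case: (hQ v).
  split=> [v|u v uv]; first by case: (hQ v).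
  by rewrite eL' //; split=> /shE.
move=> S S0 hS; have [|o [i [j h]]] := helly S S0.
  (* The Helly property of shapes also asks for [u = v], which nondegeneracy provides. *)
  move=> u v Su Sv; have [->|uv] := eqVneq u v; first exact: mL'.
  exact/shE/hS.
by exists (edge_of o i j) => v Sv; have [_ _ ->] := hQ v; exact: h.
Qed.
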